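(* Let $n\ge 1$ be an integer, let $d_n=\max\{\mathrm{d}(\pi):\pi\in S_n\}$ and $D_n=\{\pi\in S_n:\mathrm{d}(\pi)=d_n\}$. Then, for $\pi\in S_n$, we have $\pi\in D_n$ if and only if $\pi$ is crossing. Moreover, $d_n=n/2$ when $n$ is even, and $d_n=\frac{(n-1)(n+1)}{2n}$ when $n$ is odd.
   Context: $S_n$ is the set of all permutations of $N=\{1,\dots,n\}$. For $\pi\in S_n$ the displacement of $\pi$ is $\mathrm{d}(\pi)=\frac1n\sum_{i=1}^n|i-\pi(i)|$. For integers $a,b$, $[a,b]$ denotes the closed interval with endpoints $a$ and $b$, regardless of which of them is larger (so $[a,b]=[\min\{a,b\},\max\{a,b\}]$). A permutation $\pi\in S_n$ is crossing if for all $i,j\in N$ the closed intervals $[i,\pi(i)]$ and $[j,\pi(j)]$ intersect (possibly in a single point). *)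

(* Defs.v *)
From HB Require Import structures.
From mathcomp Require Import all_boot all_order all_algebra all_fingroup.
Set Implicit Arguments.
Unset Strict Implicit.
Unset Printing Implicit Defensive.
Import Order.TTheory GRing.Theory Num.Theory.
Local Open Scope ring_scope.

(* ['I_n] is 0-based while N = {1, ..., n}: the ordinal [i] is the point i + 1. *)
Definition pt (R : realFieldType) (n : nat) (i : 'I_n) : R := i.+1%:R.

Definition displacement (R : realFieldType) (n : nat) (s : 'S_n) : R :=
  n%:R^-1 * \sum_(i < n) `|pt R i - pt R (s i)|.

(* The seed is the value at a permutation, so this is the maximum over 'S_n
   itself, with no default value involved. *)
Definition max_displacement (R : realFieldType) (n : nat) : R :=
  \big[Num.max/displacement R (1%g : 'S_n)]_(s : 'S_n) displacement R s.

Definition max_displacement_set (R : realFieldType) (n : nat) : {set 'S_n} :=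
  [set s | displacement R s == max_displacement R n].

Definition segment (R : realFieldType) (a b : R) : interval R :=
  `[Num.min a b, Num.max a b].

Definition crossing (R : realFieldType) (n : nat) (s : 'S_n) : Prop :=
  forall i j : 'I_n, exists x : R,
    x \in segment (pt R i) (pt R (s i)) /\ x \in segment (pt R j) (pt R (s j)).

(* Main.v *)
Require Import Defs.
From HB Require Import structures.
From mathcomp Require Import all_boot all_order all_algebra all_fingroup.
From mathcomp Require Import zify ring lra.
Set Implicit Arguments.
Unset Strict Implicit.
Unset Printing Implicit Defensive.
Import Order.TTheory GRing.Theory Num.Theory.
Local Open Scope ring_scope.

(** Let c = (n + 1) / 2. The triangle inequality through c gives
    |i - s(i)| <= |i - c| + |s(i) - c|, with equality iff c lies in [i, s(i)];
    summed over i, the right-hand side does not depend on s. The reversal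
    attains this bound, so s is maximal iff every [i, s(i)] contains c.
    If s is crossing and some [i, s(i)] lies strictly to the left of c, with
    right endpoint m, then s maps i and all points right of m to points at
    most m, hence n - m + 1 <= m, contradicting m < c; the right side is
    symmetric. *)

Lemma leif_dist_segment (R : realFieldType) (c x y : R) :
  `|x - y| <= `|x - c| + `|y - c| ?= iff (c \in segment x y).
Proof.
rewrite /segment in_itv /=.
split; case: (ger0P (x - y)); case: (ger0P (x - c)); case: (ger0P (y - c));
  case: (lerP x y) => *; lra.
Qed.

Definition center (R : realFieldType) (n : nat) : R := n.+1%:R / 2.

Definition sum_center_dist (R : realFieldType) (n : nat) : R :=
  \sum_(i < n) `|pt R i - center R n|.

(** Removing the points 1 and n + 2, each at distance (n + 1) / 2 from the centre, leaves 2, ..., n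
    + 1: a translate by 1 of the configuration for n, centre included. *)
Lemma sum_center_distSS (R : realFieldType) (n : nat) :
  sum_center_dist R n.+2 = sum_center_dist R n + n.+1%:R.
Proof.
rewrite /sum_center_dist big_ord_recl big_ord_recr /=.
have -> : \sum_(i < n) `|pt R (lift ord0 (widen_ord (leqnSn n) i)) -
    center R n.+2| = \sum_(i < n) `|pt R i - center R n|.
  apply: eq_bigr => i _; congr `| _ |.
  by rewrite /pt /center /= /bump /= -!natr1; field.
have n_ge0 : 0 <= n%:R :> R by [].
rewrite /pt /center /= /bump /= -[n.+3%:R]natr1 -[n.+2%:R]natr1 -[n.+1%:R]natr1.
by rewrite ler0_norm ?ger0_norm; lra.
Qed.

(** The induction goes in steps of two, which preserves parity; the summand [(odd n)%:R], equal to 0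
    or 1, merges the two parities into one formula. *)
Lemma sum_center_distE (R : realFieldType) (n : nat) :
  sum_center_dist R n = (n%:R ^+ 2 - (odd n)%:R) / 4.
Proof.
elim/ltn_ind: n => -[|[|n]] IHn.
- by rewrite /sum_center_dist big_ord0 expr0n subr0 mul0r.
- rewrite /sum_center_dist big_ord1 /pt /center /= divff ?pnatr_eq0 //.
  by rewrite subrr normr0 expr1n subrr mul0r.
- by rewrite sum_center_distSS IHn //= negbK
    -[n.+2%:R]natr1 -[n.+1%:R]natr1; field.
Qed.

Lemma leif_sum_displacement (R : realFieldType) (n : nat) (s : 'S_n) :
  \sum_(i < n) `|pt R i - pt R (s i)| <= 2 * sum_center_dist R n
    ?= iff [forall i, center R n \in segment (pt R i) (pt R (s i))].
Proof.
have -> : 2 * sum_center_dist R n =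
    \sum_(i < n) (`|pt R i - center R n| + `|pt R (s i) - center R n|).
  rewrite big_split /= mulr_natl mulr2n; congr (_ + _).
  exact: (reindex_inj (@perm_inj _ s)).
by apply: leif_sum => i _; exact: leif_dist_segment.
Qed.

(** Doubling clears the denominator of (n + 1) / 2, and the shift by one in [pt] makes the left
    inequality strict. From here on the arguments are purely about natural numbers. *)
Lemma center_in_segment (R : realFieldType) (n : nat) (i j : 'I_n) :
  center R n \in segment (pt R i) (pt R j) =
  ((minn i j).*2 < n <= (maxn i j).*2.+1)%N.
Proof.
rewrite /segment in_itv /= /center /pt -natr_min -natr_max.
rewrite ler_pdivlMr // ler_pdivrMr // -!natrM !ler_nat; lia.
Qed.

(** A common point lies above the left end of one segment and below the right end of the other.
    Exchanging [i] and [j] gives the companion inequality. *)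
Lemma crossing_meet (R : realFieldType) (n : nat) (s : 'S_n) (i j : 'I_n) :
  crossing R s -> (minn j (s j) <= maxn i (s i))%N.
Proof.
move=> /(_ i j)[x []]; rewrite /segment !in_itv /=.
move=> /andP[_ x_le] /andP[le_x _]; move: (le_trans le_x x_le).
rewrite /pt -natr_min -natr_max ler_nat; lia.
Qed.

Lemma card_ord_lt (n k : nat) : (k <= n)%N -> #|[set j : 'I_n | (j < k)%N]| = k.
Proof.
move=> le_kn; rewrite -[RHS]card_ord -cardsT.
have widen_inj : injective (widen_ord le_kn).
  by move=> i j /(congr1 val) /= /val_inj.
rewrite -(card_imset _ widen_inj); apply: eq_card => j; rewrite inE.
apply/idP/imsetP => [lt_jk | [i _ ->] /=]; last exact: ltn_ord.
by exists (Ordinal lt_jk); rewrite ?inE //; apply: val_inj.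
Qed.

Lemma card_ord_ge (n k : nat) :
  (k <= n)%N -> #|[set j : 'I_n | (k <= j)%N]| = (n - k)%N.
Proof.
move=> le_kn.
have -> : [set j : 'I_n | k <= j]%N = ~: [set j : 'I_n | j < k]%N.
  by apply/setP => j; rewrite !inE leqNgt.
by rewrite cardsCs setCK card_ord card_ord_lt.
Qed.

Lemma perm_leq_card (T : finType) (s : {perm T}) (A B : {set T}) :
  {in A, forall x, s x \in B} -> (#|A| <= #|B|)%N.
Proof.
move=> sAB; rewrite -(card_imset A (@perm_inj _ s)); apply: subset_leq_card.
by apply/subsetP => _ /imsetP[x Ax ->]; apply: sAB.
Qed.

Lemma crossing_center (R : realFieldType) (n : nat) (s : 'S_n) :
  crossing R s <->
  forall i, center R n \in segment (pt R i) (pt R (s i)).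
Proof.
split=> [cr i | ctr i j]; last by exists (center R n); rewrite !ctr.
have [lt_in lt_sin] := (ltn_ord i, ltn_ord (s i)).
rewrite center_in_segment; apply/andP; split.
- set m := minn i (s i).
  have lt_mn : (m < n)%N by lia.
  have le_mn := ltnW lt_mn.
  (* Here [m] is the left end. For [j < m], the segment of [j] must reach [m], so [s j >= m]; also
     [s i >= m]. These m + 1 points inject into n - m places, whence 2m < n. *)
  have := @perm_leq_card _ s (i |: [set j : 'I_n | j < m]%N)
    [set j : 'I_n | m <= j]%N.
  rewrite card_ord_ge // cardsU1 card_ord_lt // inE.
  have -> : (i < m)%N = false by lia.
  move=> cardle; suff: (1 + m <= n - m)%N by lia.
  apply: cardle => j; rewrite !inE => /orP[/eqP-> | lt_jm]; first lia.
  have := crossing_meet j i cr; lia.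
- set m := maxn i (s i).
  have lt_mn : (m < n)%N by lia.
  (* Now [m] is the right end: [i] and the n - m - 1 points beyond [m] are sent into the m + 1
     places up to [m]. *)
  have := @perm_leq_card _ s (i |: [set j : 'I_n | m < j]%N)
    [set j : 'I_n | j < m.+1]%N.
  rewrite card_ord_lt // cardsU1 card_ord_ge // inE.
  have -> : (m < i)%N = false by lia.
  move=> cardle; suff: (1 + (n - m.+1) <= m.+1)%N by lia.
  apply: cardle => j; rewrite !inE => /orP[/eqP-> | lt_jm]; first lia.
  have := crossing_meet i j cr; lia.
Qed.

Lemma displacement_leif (R : realFieldType) (n : nat) (s : 'S_n) : (0 < n)%N ->
  displacement R s <= n%:R^-1 * (2 * sum_center_dist R n)
    ?= iff [forall i, center R n \in segment (pt R i) (pt R (s i))].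
Proof.
move=> n_gt0; have n_inv_gt0 : 0 < n%:R^-1 :> R by rewrite invr_gt0 ltr0n.
have [le_sum eq_sum] := leif_sum_displacement R s.
split; first by rewrite ler_pM2l.
by rewrite (inj_eq (mulfI (lt0r_neq0 n_inv_gt0))).
Qed.

Lemma displacement_rev (R : realFieldType) (n : nat) : (0 < n)%N ->
  displacement R (perm (@rev_ord_inj n)) =
  n%:R^-1 * (2 * sum_center_dist R n).
Proof.
move=> n_gt0; apply/eqP; rewrite (displacement_leif _ _ n_gt0).
(* The 0-based indices of a point and its mirror image add up to n - 1, so twice the smaller is at
   most n - 1 and twice the larger at least n - 1. *)
apply/forallP => i; rewrite center_in_segment permE /=.
have := ltn_ord i; lia.
Qed.

Lemma max_displacementE (R : realFieldType) (n : nat) : (0 < n)%N ->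
  max_displacement R n = n%:R^-1 * (2 * sum_center_dist R n).
Proof.
move=> n_gt0; apply/le_anti/andP; split.
  (* The seed is itself a displacement, that of the identity, so the same bound covers it. *)
  by apply: bigmax_le => [|s _]; exact: displacement_leif.
by rewrite -displacement_rev //; exact: le_bigmax.
Qed.

Theorem theorem2p5 (R : realFieldType) (n : nat) (hn : (1 <= n)%N) :
  (forall s : 'S_n, s \in max_displacement_set R n <-> crossing R s) /\
  (~~ odd n -> max_displacement R n = n%:R / 2) /\
  (odd n -> max_displacement R n = (n%:R - 1) * (n%:R + 1) / (2 * n%:R)).
Proof.
have n_neq0 : n%:R != 0 :> R by rewrite pnatr_eq0 -lt0n.
split=> [s|].
  rewrite inE max_displacementE // (displacement_leif _ _ hn).
  by rewrite crossing_center; split=> /forallP.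
rewrite max_displacementE // sum_center_distE.
by split=> [/negbTE-> | ->] /=; rewrite ?subr0; field.
Qed.
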